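(* Let $\delta \in \mathbb{N}$ be such that $\delta-1$ is a prime power. Then there exists an infinite family of bipartite $C_4$-free graphs $G$, each of order $n$ (depending on $G$) and minimum degree $\delta$, such that \[ \operatorname{avec}(G) \geq \frac{9n}{2\delta^*} - 5, \] where $\delta^* = 2\delta^2-2\delta+2$.
   Context: All graphs are finite and simple. For a connected graph $G$, the eccentricity $e_G(v)$ of a vertex $v$ is $\max_{w\in V(G)} d_G(v,w)$, where $d_G$ is the shortest-path distance, and the average eccentricity is $\operatorname{avec}(G)=\frac{1}{n}\sum_{v\in V(G)} e_G(v)$ with $n=|V(G)|$ (the graphs in the family are connected). A graph is $C_4$-free if it contains no cycle of length $4$ as a (not necessarily induced) subgraph. *)

(* Defs.v *)
From mathcomp Require Import all_boot all_order all_algebra.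

Set Implicit Arguments.
Unset Strict Implicit.
Unset Printing Implicit Defensive.

Import GRing.Theory Num.Theory.

Record sgraph := SGraph {
  vertex :> finType;
  adj : rel vertex;
  adj_sym : symmetric adj;
  adj_irr : irreflexive adj }.

Arguments adj {s}.

Definition isomorphic (G H : sgraph) : Prop :=
  exists2 f : G -> H, bijective f & forall x y, adj (f x) (f y) = adj x y.

Definition connected (G : sgraph) : Prop :=
  0 < #|G| /\ forall x y : G, connect adj x y.

Definition bipartite (G : sgraph) : Prop :=
  exists A : {set G}, forall x y : G, adj x y -> (x \in A) != (y \in A).

Definition C4_free (G : sgraph) : Prop :=
  forall s : seq G, size s = 4 -> ~ ucycle adj s.

Definition degree (G : sgraph) (v : G) : nat := #|[set w | adj v w]|.

(* Every degree is at most #|G|, so the default value of the minimum plays no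
   role as soon as G has a vertex. *)
Definition min_degree (G : sgraph) : nat :=
  \big[minn/#|G|]_(v : G) degree v.

Definition has_path (G : sgraph) (x y : G) (n : nat) : bool :=
  [exists p : n.-tuple G,
    [&& path adj x p, uniq (x :: p) & last x p == y]].

(* A path has fewer than #|G| edges; the junk value #|G| is returned exactly
   when x and y lie in different components. *)
Definition dist (G : sgraph) (x y : G) : nat :=
  find (has_path x y) (iota 0 #|G|).

Definition ecc (G : sgraph) (v : G) : nat := \max_(w : G) dist v w.

Definition avec (G : sgraph) : rat :=
  ((\sum_(v : G) ecc v)%N%:R / #|G|%:R)%R.

Definition prime_power (q : nat) : Prop :=
  exists p k : nat, [/\ prime p, 0 < k & q = p ^ k].

Definition delta_star (d : nat) : rat :=
  (2 * d%:R ^+ 2 - 2 * d%:R + 2)%R.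

(* Main.v *)
Require Import Defs.
From mathcomp Require Import all_boot all_order all_algebra.
From mathcomp Require Import all_field zify ring.

(** With q = delta - 1, the incidence graph of the projective plane over the
    field with q elements is (q+1)-regular, has girth 6 and delta^* vertices.
    Chain 2m copies of it, joining the line v of each copy to the point u of
    the next one, where u lies on v, and deleting the edge uv from every inner
    copy.  Crossing a copy then takes 5 steps and passing to the next one a
    sixth: a potential increasing by 6 per copy and 1-Lipschitz along edges
    bounds the distances from below.  The eccentricities of a vertex of copy i
    and one of copy m + i add up to at least 18 m - 10, whence an average of at
    least 9 m - 5 on the n = 2 m delta^* vertices. *)

Set Implicit Arguments.
Unset Strict Implicit.
Unset Printing Implicit Defensive.

Import Order.TTheory GRing.Theory Num.Theory.

(** * Distance bounds from potentials, and minimum degree *)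

Section Distance.
Variable G : sgraph.
Implicit Types x y : G.

(** A shortened path has fewer than [#|G|] edges, so the search defining [dist] never falls back on
    its default. *)
Lemma dist_has_path x y : connect adj x y -> has_path x y (dist x y).
Proof.
case/connectP => p0 /shortenP[p pP p_uniq _] y_last.
have size_p : size p < #|G|.
  by have := max_card (mem (x :: p)); rewrite (card_uniqP p_uniq).
have hasP : has (has_path x y) (iota 0 #|G|).
  apply/hasP; exists (size p); first by rewrite mem_iota.
  by apply/existsP; exists (in_tuple p); rewrite pP p_uniq y_last eqxx.
have := nth_find 0 hasP; rewrite nth_iota ?add0n //.
by rewrite -[X in _ < X](size_iota 0) -has_find.
Qed.

Lemma potential_dist (f : G -> nat) x y :
    (forall z t, adj z t -> f t <= (f z).+1) -> connect adj x y ->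
  f x <= f y + dist x y /\ f y <= f x + dist x y.
Proof.
move=> f_lip /dist_has_path/existsP[[p p_size] /and3P[/= pP _ /eqP y_last]].
rewrite -(eqP p_size) -y_last {p_size y_last}.
elim: p x pP => [|z p IHp] x /=; first by rewrite addn0.
case/andP => xz /IHp; have := f_lip _ _ xz.
by rewrite adj_sym in xz; have := f_lip _ _ xz; lia.
Qed.

Lemma leq_ecc x y : dist x y <= ecc x.
Proof. exact: leq_bigmax. Qed.

Lemma min_degreeE d :
    (forall x, d <= degree x) -> (exists x : G, degree x = d) ->
  min_degree G = d.
Proof.
move=> d_le [x dx]; apply/eqP; rewrite eqn_leq; apply/andP; split.
  rewrite /min_degree; elim: index_enum (mem_index_enum x) => // y s IHs.
  rewrite inE big_cons geq_min => /predU1P[<- | /IHs ->]; last exact: orbT.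
  by rewrite dx leqnn.
rewrite /min_degree; elim/big_ind: _ => //.
  by rewrite -dx max_card.
by move=> a b da db; rewrite leq_min da.
Qed.

End Distance.

(** * Bipartite incidence graphs *)

Section IncidenceGraph.
Variables (P L : finType) (B : P -> L -> bool).

Definition incidence_adj (x y : P + L) : bool :=
  match x, y with
  | inl p, inr l => B p l
  | inr l, inl p => B p l
  | _, _ => false
  end.

Lemma incidence_adj_sym : symmetric incidence_adj.
Proof. by case=> ? []. Qed.

Lemma incidence_adj_irr : irreflexive incidence_adj.
Proof. by case. Qed.

Definition incidence_graph : sgraph :=
  SGraph incidence_adj_sym incidence_adj_irr.

Lemma incidence_graph_bipartite : bipartite incidence_graph.
Proof.
exists [set x : P + L | if x is inl _ then true else false].
by case=> ? [] ? //=; rewrite !inE.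
Qed.

Lemma incidence_graph_C4_free :
    (forall p p' l l', B p l -> B p l' -> B p' l -> B p' l' ->
       p = p' \/ l = l') ->
  C4_free incidence_graph.
Proof.
move=> lin [|x [|y [|z [|t []]]]] //= _ /andP[].
case: x y z t => [x|x] [y|y] [z|z] [t|t] //=; rewrite ?andbF //.
  case/and5P => xy zy zt xt _; rewrite !inE /=.
  by case: (lin x z y t) => // ->; rewrite eqxx ?orbT ?andbF.
case/and5P => yx yz tz tx _; rewrite !inE /=.
by case: (lin y t x z) => // ->; rewrite eqxx ?orbT ?andbF.
Qed.

Lemma degree_point p :
  degree (inl p : incidence_graph) = #|[set l | B p l]|.
Proof.
rewrite /degree -(card_imset _ (@inr_inj P L)); apply: eq_card => -[p'|l].
  by rewrite !inE; apply/esym/negP => /imsetP[].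
by rewrite mem_imset ?inE //; exact: inr_inj.
Qed.

Lemma degree_line l :
  degree (inr l : incidence_graph) = #|[set p | B p l]|.
Proof.
rewrite /degree -(card_imset _ (@inl_inj P L)); apply: eq_card => -[p|l'].
  by rewrite mem_imset ?inE //; exact: inl_inj.
by rewrite !inE; apply/esym/negP => /imsetP[].
Qed.

End IncidenceGraph.

(** * The projective plane over a finite field *)

Section Plane.
Variable F : finFieldType.
Local Open Scope ring_scope.

(* Points: [Some (x, Some y)] is affine, [Some (m, None)] is the point at
   infinity of slope m, [None] the vertical point at infinity.  Lines:
   [Some (m, Some b)] is y = m x - b (the sign makes incidence symmetric),
   [Some (a, None)] is x = a, [None] is the line at infinity. *)
Definition pg := option (F * option F).

Definition pg_inc (p l : pg) : bool :=
  match p, l with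
  | None, None | None, Some (_, None) | Some (_, None), None => true
  | Some (x, Some y), Some (m, Some b) => y + b == m * x
  | Some (x, Some _), Some (a, None) | Some (x, None), Some (a, Some _) =>
      x == a
  | _, _ => false
  end.

Lemma pg_incC p l : pg_inc p l = pg_inc l p.
Proof.
case: p l => [[x [y|]]|] [[m [b|]]|] //=; try by rewrite eq_sym.
by rewrite addrC mulrC.
Qed.

Lemma card_pg : #|{: pg}| = (#|F| * #|F|.+1).+1.
Proof. by rewrite card_option card_prod card_option. Qed.

Lemma pg_inc_linear p p' l l' :
    pg_inc p l -> pg_inc p l' -> pg_inc p' l -> pg_inc p' l' ->
  p = p' \/ l = l'.
Proof.
case: p p' l l' => [[x [y|]]|] [[x' [y'|]]|] [[m [b|]]|] [[m' [b'|]]|] //=;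
  try (by do ?[move/eqP => ? | move=> _]; subst;
    do ?[left; done | right; done]).
- move=> /eqP e1 /eqP e2 /eqP e3 /eqP e4.
  (* The alternating sum of the four affine incidence equations eliminates all [y] and [b]. *)
  have : (m - m') * (x - x') == 0.
    have -> : (m - m') * (x - x') = m * x - m * x' - (m' * x - m' * x') by ring.
    by rewrite -e1 -e2 -e3 -e4; apply/eqP; ring.
  rewrite mulf_eq0 !subr_eq0 => /orP[]/eqP eq_; [right | left]; subst.
    by congr (Some (_, Some _)); apply: (@addrI _ y); rewrite e1 e2.
  by congr (Some (_, Some _)); apply: (@addIr _ b); rewrite e1 e3.
- move=> /eqP e1 /eqP? /eqP e3 /eqP?; subst; left.
  by congr (Some (_, Some _)); apply: (@addIr _ b); rewrite e1 e3.
- move=> /eqP? /eqP e1 /eqP? /eqP e3; subst; left.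
  by congr (Some (_, Some _)); apply: (@addIr _ b'); rewrite e1 e3.
- move=> /eqP e1 /eqP e3 /eqP? /eqP?; subst; right.
  by congr (Some (_, Some _)); apply: (@addrI _ y); rewrite e1 e3.
- move=> /eqP? /eqP? /eqP e1 /eqP e3; subst; right.
  by congr (Some (_, Some _)); apply: (@addrI _ y'); rewrite e1 e3.
Qed.

Lemma card_pg_inc p : #|[set l | pg_inc p l]| = #|F|.+1.
Proof.
(* Parametrises the pencil of lines through [p]; for affine [p], [Some m] is the slope and [None]
   gives the vertical line. *)
pose line (s : option F) : pg :=
  match p, s with
  | None, None | Some (_, None), None => None
  | None, Some a => Some (a, None)
  | Some (m, None), Some b => Some (m, Some b)
  | Some (x, Some _), None => Some (x, None)
  | Some (x, Some y), Some m => Some (m, Some (m * x - y))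
  end.
have line_inj : injective line.
  by rewrite /line {line}; case: p => [[x [y|]]|] [s|] [t|] // [->].
rewrite -card_option -cardsT -(card_imset _ line_inj).
apply: eq_card => l; rewrite inE; apply/idP/imsetP.
  rewrite /line {line line_inj}; case: p l => [[x [y|]]|] [[m [b|]]|] //=.
  - by move/eqP => yb; exists (Some m); rewrite // -yb addrAC subrr add0r.
  - by move/eqP =>->; exists None.
  - by move/eqP =>->; exists (Some b).
  - by exists None.
  - by exists (Some m).
  - by exists None.
case=> s _ ->; rewrite /line {line line_inj}.
by case: p s => [[x [y|]]|] [s|] //=; rewrite addrC subrK.
Qed.

End Plane.

Lemma leq_card_snd (I T : finType) (S : {set T}) (A : {set I * T}) :
  (forall y, y \in S -> exists j, (j, y) \in A) -> #|S| <= #|A|.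
Proof.
move=> SA; apply: leq_trans (leq_imset_card snd A).
apply: subset_leq_card; apply/subsetP => y /SA[j jyA].
by apply/imsetP; exists (j, y).
Qed.

(** * The chain of planes *)

Section Chain.
Variables (F : finFieldType) (n : nat).
Hypothesis n_gt0 : 0 < n.

Local Notation V := ('I_n.+1 * pg F)%type.

(* The edge uv of the plane joins the point [None] to the line [None]. *)
Definition chain_inc (p l : V) : bool :=
  let: (i, x) := p in let: (j, y) := l in
  if i == j then
    pg_inc x y && ~~ [&& x == None, y == None & 0 < i < n]
  else [&& i == j.+1 :> nat, x == None & y == None].

Definition chain := incidence_graph chain_inc.

Lemma card_chain : #|chain| = n.+1 * (#|F| * #|F|.+1).+1.*2.
Proof. by rewrite card_sum card_prod card_ord card_pg -addnn mulnDr. Qed.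

Lemma chain_incP p l : chain_inc p l ->
  (p.1 = l.1 :> nat /\ pg_inc p.2 l.2) \/
  [/\ p.1 = l.1.+1 :> nat, p.2 = None & l.2 = None].
Proof.
case: p l => [i x] [j y] /=; case: eqP => [-> /andP[]|_]; first by left.
by case/and3P => /eqP ? /eqP ? /eqP ?; right.
Qed.

(** Copy indices return to their start around a 4-cycle, so if it uses joining edges, two of them
    share an end; their other ends then coincide. Otherwise the cycle lies in one plane. *)
Lemma chain_C4_free : C4_free chain.
Proof.
have eqV (p q : V) : p.1 = q.1 :> nat -> p.2 = q.2 -> p = q.
  by case: p q => [i x] [j y] /= /val_inj -> ->.
apply: incidence_graph_C4_free => p p' l l'.
case/chain_incP => [[pl xy]|[pl x y]];
  case/chain_incP => [[pl' xy']|[pl' x_ y']];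
  case/chain_incP => [[p'l x'y]|[p'l x' y_]];
  case/chain_incP => [[p'l' x'y']|[p'l' x'_ y'_]];
  do ?[lia | by left; apply: eqV; (lia || congruence)
           | by right; apply: eqV; (lia || congruence)].
by case: (pg_inc_linear xy xy' x'y x'y') => ?; [left | right];
  apply: eqV => //; lia.
Qed.

Lemma chain_inc_block (i : 'I_n.+1) (x y : pg F) :
  pg_inc x y -> (x != None) || (y != None) -> chain_inc (i, x) (i, y).
Proof. by rewrite /chain_inc eqxx => ->; case: x y => [?|] []. Qed.

Definition block (x : chain) : 'I_n.+1 :=
  match x with inl p => p.1 | inr l => l.1 end.

(** The deleted edge is avoided by reaching in turn vertical lines, affine points, oblique lines,
    points at infinity and the line at infinity. *)
Lemma connect_block (x : chain) :
  connect adj x (inl (block x, None) : chain).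
Proof.
have point i p y : pg_inc p y -> p != None ->
    connect (@adj chain) (inr (i, y)) (inl (i, None)) ->
  connect (@adj chain) (inl (i, p)) (inl (i, None)).
  move=> py p_n; apply: connect_trans; apply: connect1.
  by apply: chain_inc_block => //; rewrite p_n.
have line i l y : pg_inc y l -> (y != None) || (l != None) ->
    connect (@adj chain) (inl (i, y)) (inl (i, None)) ->
  connect (@adj chain) (inr (i, l)) (inl (i, None)).
  move=> yl n_n; apply: connect_trans; apply: connect1.
  exact: chain_inc_block.
have vertical i a :
    connect (@adj chain) (inr (i, Some (a, None))) (inl (i, None)).
  by apply: (line _ _ None).
have affine i a b :
    connect (@adj chain) (inl (i, Some (a, Some b))) (inl (i, None)).
  by apply: (point _ _ (Some (a, None))) => //=.
have oblique i m b :
    connect (@adj chain) (inr (i, Some (m, Some b))) (inl (i, None)).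
  by apply: (line _ _ (Some (0, Some (- b)))%R) => //=; rewrite addNr mulr0.
have slope i m :
    connect (@adj chain) (inl (i, Some (m, None))) (inl (i, None)).
  by apply: (point _ _ (Some (m, Some 0%R))) => //=.
case: x => -[i [[a [b|]]|]] //=.
by apply: (line _ _ (Some (0%R, None))).
Qed.

Lemma chain_connected : connected chain.
Proof.
have csym : connect_sym (@adj chain) by apply/sym_connect_sym/adj_sym.
split; first by rewrite card_chain.
suff to0 (x : chain) : connect adj x (inl (ord0, None) : chain).
  by move=> x y; apply: connect_trans (to0 x) _; rewrite csym.
apply: connect_trans (connect_block x) _.
case: (block x) => k; elim: k => [|k IHk] k_lt.
  by rewrite (_ : Ordinal k_lt = ord0) //; apply: val_inj.
apply: connect_trans (IHk (ltnW k_lt)).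
apply: connect_trans (connect_block (inr (Ordinal (ltnW k_lt), None))).
by apply: connect1; rewrite /= -val_eqE /= eqn_leq ltnn /= eqxx.
Qed.

(** Where the edge uv is deleted, the joining edge to copy [i.-1] (for u) or [j.+1] (for v) replaces
    it. *)
Lemma chain_degree_ge (x : chain) : #|F|.+1 <= degree x.
Proof.
case: x => [[i x]|[j y]].
  rewrite degree_point -(card_pg_inc x); apply: leq_card_snd => y.
  rewrite inE => xy; case: (boolP [&& x == None, y == None & 0 < i < n]).
    case/and3P => x_ y_ /andP[i_gt0 _].
    have i_lt : i.-1 < n.+1 by have := ltn_ord i; lia.
    exists (Ordinal i_lt); rewrite inE /= x_ y_ -val_eqE /= andbT prednK //.
    rewrite eqxx.
    by case: eqP => //; lia.
  by move=> inner; exists i; rewrite inE /= eqxx xy inner.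
rewrite degree_line -(card_pg_inc y); apply: leq_card_snd => x.
rewrite inE pg_incC => xy; case: (boolP [&& x == None, y == None & 0 < j < n]).
  case/and3P => x_ y_ /andP[_ j_lt].
  have j_lt' : j.+1 < n.+1 by [].
  exists (Ordinal j_lt'); rewrite inE /= x_ y_ -val_eqE /= eqxx.
  by case: eqP => //; lia.
by move=> inner; exists j; rewrite inE /= eqxx xy inner.
Qed.

(** The first copy keeps uv and its u has no preceding copy to be joined to. *)
Lemma chain_degree0 : degree (inl (ord0, None) : chain) = #|F|.+1.
Proof.
have pair_inj : injective (pair ord0 : pg F -> V) by move=> ? ? [].
rewrite degree_point -(card_pg_inc None) -(card_imset _ pair_inj).
apply: eq_card => -[j y]; rewrite inE; apply/idP/imsetP => [|[z]].
  rewrite /chain_inc; case: eqP => [<- /andP[y_inc _]|_ //].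
  by exists y; rewrite ?inE.
by rewrite inE => z_inc [-> ->]; rewrite /chain_inc eqxx z_inc !andbF.
Qed.

Lemma chain_min_degree : min_degree chain = #|F|.+1.
Proof.
apply: min_degreeE; first exact: chain_degree_ge.
by exists (inl (ord0, None)); exact: chain_degree0.
Qed.

(* In an inner copy, the distance from the point [None] once its edge to the
   line [None] is deleted; in the first (last) copy, where this edge is kept,
   5 minus the distance to [None] (the distance from [None]). *)
Definition offset (x : chain) : nat :=
  match x with
  | inl (i, None) => if i == 0 :> nat then 4 else 0
  | inl (i, Some (_, None)) => if i == n :> nat then 2 else 4
  | inl (_, Some (_, Some _)) => 2
  | inr (i, None) => if i == n :> nat then 1 else 5
  | inr (i, Some (_, None)) => if i == 0 :> nat then 3 else 1
  | inr (_, Some (_, Some _)) => 3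
  end.

Definition potential (x : chain) : nat := 6 * block x + offset x.

Lemma potential_lip (x y : chain) : adj x y -> potential y <= (potential x).+1.
Proof.
have lip p l : chain_inc p l ->
    potential (inl p) <= (potential (inr l)).+1 /\
    potential (inr l) <= (potential (inl p)).+1.
  case: p l => [i p] [j l]; rewrite /chain_inc /potential /=.
  case: eqP => [<-|_].
    case: p l => [[a [b|]]|] [[c [d|]]|] //=;
      have := ltn_ord i; do ?case: eqP; lia.
  by case/and3P => /eqP ij /eqP-> /eqP->; have := ltn_ord i; do ?case: eqP; lia.
by case: x y => [p|l] [p'|l'] //= /lip[].
Qed.

Lemma ecc_chain (x : chain) :
  maxn (6 * n - 2 - 6 * block x) (6 * block x - 2) <= ecc x.
Proof.
have off_le : offset x <= 5.
  by case: x => -[i [[a [b|]]|]] /=; do ?case: ifP.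
have [_ conn] := chain_connected.
(* [far] and [near] have the extreme potentials [6 * n + 3] and [2]. *)
pose far : chain := inr (ord_max, Some (0, Some 0))%R.
pose near : chain := inl (ord0, Some (0, Some 0))%R.
have [_] := potential_dist potential_lip (conn x far).
have [] := potential_dist potential_lip (conn x near).
move: (leq_ecc x near) (leq_ecc x far); rewrite /potential /=; lia.
Qed.

End Chain.

(** Pair [i] with [m + i], using the first entry of the maximum at [i] and the second at [m + i]:
    [(12 * m - 8 - 6 * i) + (6 * m + 6 * i - 2)]. *)
Lemma sum_ecc_bound (m : nat) :
  m * (18 * m - 10) <=
    \sum_(i < m + m) maxn (6 * (m + m).-1 - 2 - 6 * i) (6 * i - 2).
Proof.
rewrite big_split_ord /= -big_split /=.
rewrite -[X in X * _ <= _]card_ord -sum_nat_const; apply: leq_sum => i _.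
by have := ltn_ord i; lia.
Qed.

Theorem theorem3 (delta : nat) (hdelta : prime_power (delta - 1)) :
  exists G : nat -> sgraph,
    (forall i j : nat, i <> j -> ~ isomorphic (G i) (G j)) /\
    (forall i : nat,
       [/\ connected (G i), bipartite (G i), C4_free (G i),
           min_degree (G i) = delta
         & (9 * #|G i|%:R / (2 * delta_star delta) - 5 <= avec (G i))%R]).
Proof.
have [p [k [p_prime k_gt0 q_def]]] := hdelta.
have [F _ cardF] := PrimePowerField p_prime k_gt0.
have q_gt0 : 0 < delta - 1 by rewrite q_def expn_gt0 prime_gt0.
have delta_def : #|F|.+1 = delta by rewrite cardF -q_def; lia.
(* This chain has [2 * i.+1] copies, an even number as the pairing requires; distinct orders exclude
   isomorphisms. *)
exists (fun i => chain F (i + i.+1)); split=> [i j ij [f /bij_eq_card]|i].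
  rewrite !card_chain => /eqP; rewrite eqn_pmul2r // => /eqP; lia.
have n_gt0 : 0 < i + i.+1 by rewrite addnS.
split.
- exact: chain_connected.
- exact: incidence_graph_bipartite.
- exact: chain_C4_free.
- by rewrite chain_min_degree.
set N := (#|F| * #|F|.+1).+1; set m := i.+1.
have sum_ge :
    N.*2 * (m * (18 * m - 10)) <= \sum_(v : chain F (i + m)) ecc v.
  pose c (j : nat) := maxn (6 * (i + m) - 2 - 6 * j) (6 * j - 2).
  (* The bound depends on the copy alone, and each copy has [N] points and [N] lines. *)
  have side : N * (m * (18 * m - 10)) <= \sum_(v : 'I_(i + m).+1 * pg F) c v.1.
    rewrite -(pair_bigA _ (fun (j : 'I__) (_ : pg F) => c j)) /=.
    under eq_bigr do rewrite sum_nat_const card_pg -/N.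
    by rewrite -big_distrr leq_mul2l sum_ecc_bound orbT.
  rewrite big_sumType -addnn mulnDl; apply: leq_add;
    by apply: (leq_trans side); apply: leq_sum => v _; exact: ecc_chain.
have delta_starE : (delta_star delta = (N.*2)%:R)%R.
  by rewrite -delta_def /delta_star /N -addnn natrD -!natr1 natrM -!natr1; ring.
have size_chain : (#|chain F (i + m)|%:R = 2 * m%:R * (N.*2)%:R :> rat)%R.
  by rewrite card_chain -addSn addnn -muln2 !natrM [(_ * 2)%R]mulrC.
have m_gt0 : (0 < m%:R :> rat)%R by rewrite ltr0n.
have N_gt0 : (0 < (N.*2)%:R :> rat)%R by rewrite ltr0n.
rewrite /avec delta_starE size_chain ler_pdivlMr ?mulr_gt0 //.
(* Since [m] is positive, [18 * m - 10] is not truncated; after division by the order, both sides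
   equal [9 * m - 5]. *)
move: sum_ge; rewrite -(ler_nat rat) natrM natrM natrB ?natrM; last by lia.
apply: le_trans; rewrite le_eqVlt; apply/orP; left; apply/eqP.
by field; rewrite lt0r_neq0.
Qed.
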